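(* Let $m\ge 1$. The map $\mathcal{V}:\mathbb{S}_m\to\mathbb{R}^{m(m+1)/2}$ is a diffeomorphism (in particular a continuous bijection mapping compact sets to compact sets), and for all $S,T\in\mathbb{S}_m$, $$d_C(\mathscr{L}S,\mathscr{L}T)=\|\mathcal{V}(S)-\mathcal{V}(T)\|.$$ Consequently, for every finite nonempty set $\mathcal{Z}\subseteq\mathbb{S}_m$, the empirical Fréchet mean of $\mathcal{Z}$ with respect to the log-Cholesky distance is $$\overline{S}=\mathcal{V}^{-1}\Big(\frac{1}{|\mathcal{Z}|}\sum_{S\in\mathcal{Z}}\mathcal{V}(S)\Big),$$ and, for every $k\ge1$, a partition of $\mathcal{Z}$ into $k$ disjoint (possibly empty) subsets $\mathcal{Z}_1,\dots,\mathcal{Z}_k$ solves the log-Cholesky $k$-means problem for $\mathcal{Z}$ if and only if $\mathcal{V}(\mathcal{Z}_1),\dots,\mathcal{V}(\mathcal{Z}_k)$ solves the Euclidean $k$-means problem for $\mathcal{V}(\mathcal{Z})$.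
   Context: $\mathbb{S}_m$ is the set of $m\times m$ real symmetric positive definite matrices, an open subset of the space of symmetric matrices. $\mathbb{L}_m$ is the set of $m\times m$ lower triangular real matrices with positive diagonal. $\mathscr{L}:\mathbb{S}_m\to\mathbb{L}_m$ sends $S$ to its Cholesky factor, the unique $L\in\mathbb{L}_m$ with $S=LL^T$; it is a diffeomorphism. For a matrix $L$, $\lfloor L\rfloor$ is its strictly lower triangular part and $\mathbf{D}(L)$ its diagonal part (off-diagonal entries set to $0$). For $L,K\in\mathbb{L}_m$, $$d_C^2(L,K)=\|\lfloor L\rfloor-\lfloor K\rfloor\|_F^2+\|\mathrm{Log}(\mathbf{D}(L))-\mathrm{Log}(\mathbf{D}(K))\|_F^2,$$ where $\|\cdot\|_F$ is the Frobenius norm and $\mathrm{Log}$ of a positive diagonal matrix is taken entrywise on the diagonal. The log-Cholesky distance on $\mathbb{S}_m$ is $d(S,T)=d_C(\mathscr{L}S,\mathscr{L}T)$. $\mathcal{V}(S)=(\ell_1,\dots,\ell_{m(m-1)/2},d_1,\dots,d_m)^T$, where $\ell_1,\dots,\ell_{m(m-1)/2}$ are the strictly lower triangular entries of $\mathscr{L}S$ listed in a fixed order and $d_i=\log((\mathscr{L}S)_{ii})$; $\|\cdot\|$ is the Euclidean norm. In a metric space $(\mathcal{M},d)$, for a finite set $\mathcal{Z}$, the empirical dispersion is $\sigma^2(a,\mathcal{Z})=\sum_{S\in\mathcal{Z}}d^2(a,S)$, and the empirical Fréchet mean is its (unique) minimiser over $a\in\mathcal{M}$. The $k$-means problem for $\mathcal{Z}$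 is to find a partition of $\mathcal{Z}$ into disjoint subsets $\mathcal{Z}_1,\dots,\mathcal{Z}_k$ (some possibly empty) minimising $\sum_{j=1}^k\sigma^2(\overline{S}_j,\mathcal{Z}_j)$, where $\overline{S}_j$ is the empirical Fréchet mean of $\mathcal{Z}_j$ and empty clusters contribute $0$. The log-Cholesky problem uses $(\mathbb{S}_m,d)$ and the Euclidean problem uses $\mathbb{R}^{m(m+1)/2}$ with the Euclidean distance. *)

(* Defs.v *)
(* The reals are an arbitrary realType. *)
From HB Require Import structures.
From mathcomp Require Import all_boot all_order all_algebra finmap.
From mathcomp Require Import all_classical all_reals all_analysis.

Set Implicit Arguments.
Unset Strict Implicit.
Unset Printing Implicit Defensive.

Import Order.TTheory GRing.Theory Num.Theory numFieldNormedType.Exports.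

Local Open Scope classical_set_scope.
Local Open Scope ring_scope.

(* 'D_v1 ('D_v2 (... f)) for vs = [:: v1; v2; ...]. *)
Definition iter_derive (R : realType) (V W : normedModType R)
    (vs : seq V) (f : V -> W) : V -> W :=
  foldr (fun v g => 'D_v g) f vs.

(* C^oo on U, for U a relatively open subset of the linear subspace E of a
   finite-dimensional space V: all iterated directional derivatives along
   vectors of E exist and are continuous on U. As x + h v stays in U for
   x in U, v in E and h small, this depends only on the values of f on U. *)
Definition smooth_on (R : realType) (V W : normedModType R)
    (E U : set V) (f : V -> W) : Prop :=
  forall vs : seq V, (forall v, v \in vs -> E v) ->
    {within U, continuous (iter_derive vs f)} /\
    (forall x v, U x -> E v -> derivable (iter_derive vs f) x v).

(* Inverse of a map that is injective on U; 0 outside of f @` U. *)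
Definition inverse_on (R : realType) (V W : normedModType R)
    (U : set V) (f : V -> W) : W -> V :=
  'pinv_(fun=> 0) U f.

Definition diffeomorphism (R : realType) (V W : normedModType R)
    (E U : set V) (E' U' : set W) (f : V -> W) : Prop :=
  [/\ set_bij U U' f, smooth_on E U f & smooth_on E' U' (inverse_on U f)].

(* On column vectors this is the Euclidean norm (the library's norm on
   matrices is the sup norm, which induces the same topology). *)
Definition frob (R : realType) (p q : nat) (A : 'M[R]_(p, q)) : R :=
  Num.sqrt (\sum_i \sum_j A i j ^+ 2).

Definition symm (R : realType) (m : nat) : set 'M[R]_m := [set S | S^T = S].

Definition spd (R : realType) (m : nat) : set 'M[R]_m :=
  [set S | S^T = S /\
           forall x : 'cV[R]_m, x != 0 -> 0 < (x^T *m S *m x) 0 0].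

(* is_trig_mx: zero above the diagonal. *)
Definition lower_pos (R : realType) (m : nat) : set 'M[R]_m :=
  [set L | is_trig_mx L /\ forall i, 0 < L i i].

Definition chol (R : realType) (m : nat) (S : 'M[R]_m) : 'M[R]_m :=
  get [set L | lower_pos L /\ S = L *m L^T].

Definition strict_lower (R : realType) (m : nat) (L : 'M[R]_m) : 'M[R]_m :=
  \matrix_(i, j) (if (j < i)%N then L i j else 0).

Definition diag_part (R : realType) (m : nat) (L : 'M[R]_m) : 'M[R]_m :=
  diag_mx (\row_i L i i).

Definition diag_log (R : realType) (m : nat) (D : 'M[R]_m) : 'M[R]_m :=
  diag_mx (\row_i ln (D i i)).

Definition dC (R : realType) (m : nat) (L K : 'M[R]_m) : R :=
  Num.sqrt (frob (strict_lower L - strict_lower K) ^+ 2 +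
            frob (diag_log (diag_part L) - diag_log (diag_part K)) ^+ 2).

Definition dLC (R : realType) (m : nat) (S T : 'M[R]_m) : R :=
  dC (chol S) (chol T).

Definition dE (R : realType) (n : nat) (u v : 'cV[R]_n) : R := frob (u - v).

(* An ordering of the strictly lower triangular positions (row, column). *)
Definition lower_order (m : nat) (e : 'I_(m * m.-1)./2 -> 'I_m * 'I_m) : Prop :=
  injective e /\
  (forall ij : 'I_m * 'I_m, (exists p, e p = ij) <-> (ij.2 < ij.1)%N).

Lemma dim_split (m : nat) : ((m * m.-1)./2 + m = (m * m.+1)./2)%N.
Proof. by rewrite [(m * m.+1)%N]mulnC -bin2 -(bin2 m.+1) binS bin1. Qed.

Definition logchol (R : realType) (m : nat)
    (e : 'I_(m * m.-1)./2 -> 'I_m * 'I_m) (S : 'M[R]_m) :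
    'cV[R]_(m * m.+1)./2 :=
  castmx (dim_split m, erefl 1%N)
    (col_mx (\col_p chol S (e p).1 (e p).2) (\col_i ln (chol S i i))).

Definition dispersion (R : realType) (T : pointedType) (d : T -> T -> R)
    (a : T) (Z : {fset T}) : R :=
  \sum_(S <- Z) d a S ^+ 2.

Definition is_frechet_mean (R : realType) (T : pointedType) (M : set T)
    (d : T -> T -> R) (Z : {fset T}) (a : T) : Prop :=
  [/\ M a, (forall b, M b -> dispersion d a Z <= dispersion d b Z)
    & forall b, M b ->
        (forall c, M c -> dispersion d b Z <= dispersion d c Z) -> b = a].

Definition frechet_mean (R : realType) (T : pointedType) (M : set T)
    (d : T -> T -> R) (Z : {fset T}) : T :=
  get (is_frechet_mean M d Z).

Definition is_kpartition (T : pointedType) (k : nat) (Z : {fset T})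
    (P : 'I_k -> {fset T}) : Prop :=
  (forall S, S \in Z <-> exists j, S \in P j) /\
  (forall i j, i != j -> [disjoint P i & P j]%fset).

Definition kmeans_cost (R : realType) (T : pointedType) (M : set T)
    (d : T -> T -> R) (k : nat) (P : 'I_k -> {fset T}) : R :=
  \sum_(j < k | P j != fset0)
     dispersion d (frechet_mean M d (P j)) (P j).

Definition solves_kmeans (R : realType) (T : pointedType) (M : set T)
    (d : T -> T -> R) (k : nat) (Z : {fset T}) (P : 'I_k -> {fset T}) : Prop :=
  is_kpartition Z P /\
  (forall Q : 'I_k -> {fset T}, is_kpartition Z Q ->
     kmeans_cost M d P <= kmeans_cost M d Q).

(* Main.v *)
Require Import Defs.
From HB Require Import structures.
From mathcomp Require Import all_boot all_order all_algebra finmap.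
From mathcomp Require Import ring lra all_classical all_reals all_analysis.

Set Implicit Arguments.
Unset Strict Implicit.
Unset Printing Implicit Defensive.

Import Order.TTheory GRing.Theory Num.Theory numFieldNormedType.Exports.

Local Open Scope classical_set_scope.
Local Open Scope ring_scope.

(* Call a function on U elementary if it is built from constants and
   coordinates by sums, products, exp, and ln of functions positive on U. The
   directional derivatives of elementary functions are again elementary, so
   elementary functions are smooth. Solving S = L L^T column by column shows
   that the entries of the Cholesky factor L are elementary in S, and those of
   the inverse of V, which is w |-> L_w L_w^T with an explicit L_w, are
   elementary in w. Since V is an isometry onto a Euclidean space, Frechet means
   and k-means solutions correspond through V, and the Euclidean Frechet mean is
   the centroid by sum |a - u|^2 = sum |c - u|^2 + n |a - c|^2. *)

(** * Elementary functions are smooth *)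

Section ElementaryFunctions.
Variables (R : realType) (p q : nat).
Implicit Types (E U : set 'M[R]_(p, q)) (f g : 'M[R]_(p, q) -> R).

(** The clause [elementary_ext] makes the class depend only on values on [U]; this matters because
    [chol] takes arbitrary values off the positive definite matrices. *)
Inductive elementary U : ('M[R]_(p, q) -> R) -> Prop :=
| elementary_cst c : elementary U (fun=> c)
| elementary_coord i j : elementary U (fun x => x i j)
| elementaryD f g : elementary U f -> elementary U g ->
    elementary U (fun x => f x + g x)
| elementaryM f g : elementary U f -> elementary U g ->
    elementary U (fun x => f x * g x)
| elementary_expR f : elementary U f -> elementary U (fun x => expR (f x))
| elementary_ln f : (forall x, U x -> 0 < f x) -> elementary U f ->
    elementary U (fun x => ln (f x))
| elementary_ext f g : (forall x, U x -> f x = g x) -> elementary U f ->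
    elementary U g.

Lemma elementary_sum U (I : Type) (r : seq I) (P : pred I)
    (F : I -> 'M[R]_(p, q) -> R) :
  (forall i, P i -> elementary U (F i)) ->
  elementary U (fun x => \sum_(i <- r | P i) F i x).
Proof.
move=> eF; elim: r => [|i r ih].
  apply: elementary_ext (elementary_cst U 0) => x _.
  by rewrite big_nil.
case Pi: (P i).
  apply: elementary_ext (elementaryD (eF i Pi) ih) => x _.
  by rewrite big_cons Pi.
by apply: elementary_ext ih => x _; rewrite big_cons Pi.
Qed.

Lemma elementaryN U f : elementary U f -> elementary U (fun x => - f x).
Proof.
move=> /(elementaryM (elementary_cst U (-1))); apply: elementary_ext => x _.
by rewrite mulN1r.
Qed.

(** A positive function has inverse exp(- ln f), so reciprocals need no constructor of their own. *)
Lemma elementaryV U f : (forall x, U x -> 0 < f x) -> elementary U f ->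
  elementary U (fun x => (f x)^-1).
Proof.
move=> f_gt0 /(elementary_ln f_gt0)/elementaryN/elementary_expR.
by apply: elementary_ext => x Ux; rewrite expRN lnK// posrE f_gt0.
Qed.

(** Limits are taken within [U] because [U] need not be open in the whole matrix space. *)
Lemma elementary_cvg U f : elementary U f ->
  forall x, U x -> f @ within U (nbhs x) --> f x.
Proof.
elim=> [c|i j|{}f g _ cf _ cg|{}f g _ cf _ cg|{}f _ cf|{}f f_gt0 _ cf
       |{}f g fg _ cf] x Ux.
- exact: cvg_cst.
- by apply: cvg_within_filter; exact: coord_continuous.
- by apply: cvgD; [exact: cf | exact: cg].
- by apply: cvgM; [exact: cf | exact: cg].
- apply: continuous_cvg (cf _ Ux).
  exact: continuous_expR.
- apply: continuous_cvg (cf _ Ux).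
  exact/continuous_ln/f_gt0.
- rewrite -fg//; apply: cvg_trans (cf _ Ux).
  by apply: fmap_within_eq => y; rewrite inE => /fg.
Qed.

(** Both difference quotients coincide. This reduces directional derivatives to one real variable,
    where the chain rule and locality are available. *)
Lemma is_derive_line (W : normedModType R) (F : 'M[R]_(p, q) -> W) x v df :
  is_derive x v F df <->
  is_derive (0 : R) 1 (fun h : R => F (h *: v + x)) df.
Proof.
have Fh : (fun h : R => h^-1 *: ((F \o shift x) (h *: v) - F x)) =
    (fun h : R => h^-1 *: (((fun h : R => F (h *: v + x)) \o shift 0) (h *: 1)
                         - F (0 *: v + x))).
  by apply/funext => h; rewrite /= addr0 scale0r add0r [h *: 1]mulr1.
split=> -[]; rewrite /derivable /derive.
  rewrite Fh => H1 H2; split; first by rewrite /derivable.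
  by rewrite /derive.
move=> H1 H2; split; first by rewrite /derivable Fh.
by rewrite /derive Fh.
Qed.

(** This form of relative openness is what makes derivatives along [E] at points of [U] depend only
    on the values on [U]. *)
Definition open_along E U := forall x v, U x -> E v ->
  \forall h \near (0 : R), U (h *: v + x).

Lemma is_derive_ext_on (W : normedModType R) E U (F G : 'M[R]_(p, q) -> W)
    x v df : open_along E U -> U x -> E v -> (forall y, U y -> F y = G y) ->
  is_derive x v F df -> is_derive x v G df.
Proof.
move=> oU Ux Ev FG /is_derive_line dF; apply/is_derive_line.
apply: near_eq_is_derive dF.
by apply: filterS (oU _ _ Ux Ev) => h /FG.
Qed.

Lemma is_derive_comp1 (phi : R -> R) f x v a b :
  is_derive (f x) 1 phi a -> is_derive x v f b ->
  is_derive x v (fun y => phi (f y)) (a * b).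
Proof.
move=> dphi /is_derive_line df; apply/is_derive_line.
apply: (is_derive1_comp (f := phi) (g := fun h : R => f (h *: v + x))).
by rewrite scale0r add0r.
Qed.

(** Induction on the construction of [f]: each differentiation rule yields an expression of the same
    class, reciprocals from ln included. *)
Lemma elementary_derive E U f v : open_along E U -> E v -> elementary U f ->
  exists2 g, elementary U g & forall x, U x -> is_derive x v f (g x).
Proof.
move=> oU Ev; elim=> [c|i j|{}f g ef [f' ef' df] eg [g' eg' dg]
  |{}f g ef [f' ef' df] eg [g' eg' dg]|{}f ef [f' ef' df]
  |{}f f_gt0 ef [f' ef' df]|{}f g fg ef [f' ef' df]].
- exists (fun=> 0); first exact: elementary_cst.
  by move=> x _; exact: is_derive_cst.
- exists (fun=> v i j); first exact: elementary_cst.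
  move=> x _; apply/is_derive_line.
  have -> : (fun h : R => (h *: v + x) i j) = (v i j \*: id) + cst (x i j).
    by apply/funext => h; rewrite !fctE !mxE mulrC.
  apply: is_derive_eq.
  by rewrite addr0 [_ *: 1]mulr1.
- exists (fun x => f' x + g' x); first exact: elementaryD.
  by move=> x Ux; apply: is_deriveD; [exact: df | exact: dg].
- exists (fun x => f x * g' x + g x * f' x).
    by apply: elementaryD; exact: elementaryM.
  by move=> x Ux; apply: is_deriveM; [exact: df | exact: dg].
- exists (fun x => expR (f x) * f' x).
    by apply: elementaryM => //; exact: elementary_expR.
  by move=> x Ux; apply: is_derive_comp1 (df x Ux); exact: is_derive_expR.
- exists (fun x => (f x)^-1 * f' x).
    by apply: elementaryM => //; exact: elementaryV.
  move=> x Ux; apply: is_derive_comp1 (df x Ux).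
  exact/is_derive1_ln/f_gt0.
- exists f' => // x Ux; exact: is_derive_ext_on oU Ux Ev fg (df x Ux).
Qed.

(** By induction on the list of directions, the entries of every iterated derivative are elementary,
    hence continuous on [U] and derivable along [E]. *)
Lemma smooth_on_elementary (k l : nat) E U (F : 'M[R]_(p, q) -> 'M[R]_(k, l)) :
  open_along E U -> (forall i j, elementary U (fun x => F x i j)) ->
  smooth_on E U F.
Proof.
move=> oU eF vs Evs.
have {eF} : forall i j, elementary U (fun x => iter_derive vs F x i j).
  elim: vs Evs => [//|v vs ih] Evs i j.
  have Ev : E v by apply: Evs; rewrite mem_head.
  have {}ih := ih (fun u uvs => Evs u (@mem_behead _ (v :: vs) _ uvs)).
  have [g eg dg] := elementary_derive oU Ev (ih i j).
  apply: elementary_ext eg => x Ux /=; rewrite derive_mx; last first.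
    apply/derivable_mxP => i' j'.
    by have [g' _ /(_ x Ux)[]] := elementary_derive oU Ev (ih i' j').
  by rewrite mxE; have [_ <-] := dg x Ux.
move: (iter_derive vs F) => G eG; split.
  apply/subspace_continuousP => x Ux.
  apply/cvgrPdist_le => /= r r0.
  (* The matrix norm is the maximum over the entries, so finitely many entrywise estimates
     suffice. *)
  near=> y.
  rewrite [leLHS]/Num.Def.normr/= mx_normrE (bigmax_le _ (ltW r0))//= => i _.
  rewrite !mxE/=; move: i; near: y; apply: filter_forall => /= i.
  by have /cvgrPdist_le /(_ _ r0) := elementary_cvg (eG i.1 i.2) Ux.
move=> x v Ux Ev; apply/derivable_mxP => i j.
by have [g _ /(_ x Ux)[]] := elementary_derive oU Ev (eG i j).
Unshelve. all: by end_near. Qed.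

End ElementaryFunctions.

(** * The Cholesky factor *)

Section Cholesky.
Variable R : realType.
Implicit Type m : nat.

(** The Schur complement is what remains after eliminating the first row and column; its positivity
    drives the induction in [cholesky_exists]. *)
Lemma schur_spd n (a : R) (b : 'cV[R]_n) (C : 'M[R]_n) : a != 0 ->
  spd (block_mx a%:M b^T b C) -> spd (C - a^-1 *: (b *m b^T)).
Proof.
move=> a_neq0 [symS posS].
have symC : C^T = C.
  by move: symS; rewrite tr_block_mx => /eq_block_mx[].
split=> [|y y_neq0]; first by rewrite linearB/= linearZ/= trmx_mul trmxK symC.
(* [x] minimises the quadratic form of the block matrix over its first block. *)
pose x := col_mx (- a^-1 *: (b^T *m y)) y.
have /posS : x != 0.
  by apply: contra_neq y_neq0; rewrite -col_mx0 => /eq_col_mx[].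
rewrite -mulmxA mul_block_col mul_scalar_mx scalerA mulrN divff// scaleN1r.
rewrite addNr tr_col_mx mul_row_col mulmx0 add0r -scalemxAr scaleNr addrC.
by rewrite -[in X in _ -> X]mulmxA mulmxBl -scalemxAl mulmxA.
Qed.

(** Induction on the size: the first column of the factor is that of [S] divided by the square root
    of the pivot [a], and the remaining block factors the Schur complement. *)
Lemma cholesky_exists m (S : 'M[R]_m) : spd S ->
  exists L, lower_pos L /\ S = L *m L^T.
Proof.
elim: m S => [|n ih] S spdS.
  exists 0; split; last by rewrite thinmx0 [RHS]thinmx0.
  by split=> [|[]//]; apply/is_trig_mxP => -[].
move: S spdS; rewrite -[n.+1]/(1 + n)%N => S.
rewrite -[S]submxK; set a := ulsubmx S; set b := dlsubmx S; set C := drsubmx S.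
rewrite [a]mx11_scalar; move: (a 0 0) => {}a spdS.
have a_gt0 : 0 < a.
  (* The quadratic form at the first basis vector is the pivot. *)
  have /spdS.2 : col_mx 1%:M 0 != 0 :> 'cV[R]_(1 + n).
    rewrite -col_mx0; apply/eqP => /eq_col_mx[/matrixP/(_ 0 0)].
    by rewrite !mxE => /eqP; rewrite oner_eq0.
  rewrite -mulmxA mul_block_col !mulmx0 !addr0 tr_col_mx mul_row_col trmx0.
  by rewrite mul0mx addr0 trmx1 mul1mx mulmx1 mxE.
have ur : ursubmx S = b^T.
  have [+ _] := spdS.
  by rewrite tr_block_mx => /eq_block_mx[_ <- _ _].
move: spdS; rewrite ur => spdS.
have [L [[trigL posL] LE]] := ih _ (schur_spd (lt0r_neq0 a_gt0) spdS).
have sa_gt0 : 0 < Num.sqrt a by rewrite sqrtr_gt0.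
exists (block_mx (Num.sqrt a)%:M 0 ((Num.sqrt a)^-1 *: b) L).
split; first split.
- rewrite is_trig_block_mx// eqxx trigL andbT/=.
  by apply/is_trig_mxP => -[[|//] ?] [[|//] ?].
- move=> i; case: (split_ordP i) => j ->.
    by rewrite block_mxEul mxE eqxx mulr1n.
  by rewrite block_mxEdr.
- rewrite tr_block_mx mulmx_block trmx0 !mul0mx !mulmx0 !addr0 tr_scalar_mx.
  rewrite -scalar_mxM -expr2 sqr_sqrtr ?ltW// -LE linearZ/= mul_scalar_mx.
  rewrite mul_mx_scalar !scalerA divff ?lt0r_neq0// !scale1r.
  rewrite -scalemxAl -scalemxAr scalerA.
  by rewrite -invfM -expr2 sqr_sqrtr ?ltW// addrC subrK.
Qed.

(** The Cholesky recursion: terms beyond [j] vanish, and splitting off the term [j] expresses column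
    [j] through the earlier columns. *)
Lemma cholesky_entry m (L : 'M[R]_m) (i j : 'I_m) : is_trig_mx L ->
  (L *m L^T) i j = \sum_(k < m | (k < j)%N) L i k * L j k + L i j * L j j.
Proof.
move=> /is_trig_mxP trigL; rewrite mxE (bigID (fun k : 'I_m => (k < j)%N))/=.
congr (_ + _); first by apply: eq_bigr => k _; rewrite mxE.
rewrite (bigD1 j) ?ltnn//= big1 ?addr0 ?mxE// => k /andP[].
rewrite -leqNgt => jk k_neq; rewrite mxE (trigL j k) ?mulr0//.
by rewrite ltn_neqAle jk eq_sym (inj_eq val_inj) k_neq.
Qed.

(** Strong induction on the column: once earlier columns agree, row [j] determines the square of the
    positive pivot, and the other rows follow by division. *)
Lemma cholesky_unique m (L K : 'M[R]_m) : lower_pos L -> lower_pos K ->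
  L *m L^T = K *m K^T -> L = K.
Proof.
move=> [trigL posL] [trigK posK] /matrixP LK.
suff LKij (n : nat) (i j : 'I_m) :
    nat_of_ord j = n -> (j <= i)%N -> L i j = K i j.
  apply/matrixP => i j; have [ij|ji] := ltnP i j; last exact: LKij ji.
  by rewrite (is_trig_mxP trigL)// (is_trig_mxP trigK).
elim/ltn_ind: n i j => n ih i j jn ji.
have rec (i' : 'I_m) : (j <= i')%N -> L i' j * L j j = K i' j * K j j.
  move=> ji'; have := LK i' j; rewrite !cholesky_entry//.
  rewrite (eq_bigr (fun k => K i' k * K j k)); first exact: addrI.
  move=> k kj; rewrite (ih k _ _ k) -?jn//; last exact: leq_trans (ltnW kj) ji'.
  by rewrite (ih k _ j k) -?jn// ltnW.
have Ljj : L j j = K j j.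
  apply/eqP; rewrite -(eqrXn2 (isT : (0 < 2)%N)) ?ltW// !expr2.
  exact/eqP/rec.
by have := rec i ji; rewrite Ljj => /mulIf; apply; rewrite gt_eqF.
Qed.

Lemma cholP m (S : 'M[R]_m) : spd S ->
  lower_pos (chol S) /\ S = chol S *m (chol S)^T.
Proof. by move=> /cholesky_exists/getPex. Qed.

Lemma chol_mul_tr m (L : 'M[R]_m) : lower_pos L -> chol (L *m L^T) = L.
Proof.
move=> posL; apply: get_subset1 => // K K' [posK KE] [posK' K'E].
by apply: cholesky_unique => //; rewrite -KE.
Qed.

Lemma lower_pos_unitmx m (L : 'M[R]_m) : lower_pos L -> L \in unitmx.
Proof.
move=> [trigL posL]; rewrite unitmxE det_trig// unitfE prodf_seq_neq0.
by apply/allP => i _; rewrite gt_eqF.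
Qed.

Lemma mulmx_tr_col m (y : 'cV[R]_m) : (y^T *m y) 0 0 = \sum_i y i 0 ^+ 2.
Proof. by rewrite mxE; apply: eq_bigr => i _; rewrite mxE expr2. Qed.

Lemma sum_sqr_gt0 m (y : 'cV[R]_m) : y != 0 -> 0 < \sum_i y i 0 ^+ 2.
Proof.
move=> y_neq0; rewrite lt_def sumr_ge0 ?andbT; last by move=> *; exact: sqr_ge0.
apply: contra_neq y_neq0 => /eqP.
rewrite psumr_eq0; last by move=> *; exact: sqr_ge0.
move=> /allP y0; apply/colP => i; rewrite mxE; apply/eqP.
by rewrite -sqrf_eq0; apply: (implyP (y0 i (mem_index_enum i))).
Qed.

(** The quadratic form at x is the squared Euclidean norm of L^T x, and L^T is invertible. *)
Lemma spd_mul_tr m (L : 'M[R]_m) : lower_pos L -> spd (L *m L^T).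
Proof.
move=> posL; split=> [|x x_neq0]; first by rewrite trmx_mul trmxK.
rewrite mulmxA -mulmxA -[x^T *m L]trmxK trmx_mul trmxK mulmx_tr_col.
apply: sum_sqr_gt0; apply: contra_neq x_neq0 => Lx0.
rewrite -(mulKmx (_ : L^T \in unitmx) x) ?Lx0 ?mulmx0//.
by rewrite unitmx_tr lower_pos_unitmx.
Qed.

Lemma quadratic_form_bound m (B : 'M[R]_m) (y : 'cV[R]_m) :
  `|(y^T *m B *m y) 0 0| <= (\sum_i \sum_j `|B i j|) * \sum_i y i 0 ^+ 2.
Proof.
set N := \sum_i _ ^+ 2; have yN i : y i 0 ^+ 2 <= N.
  rewrite /N (bigD1 i)//= lerDl sumr_ge0// => *; exact: sqr_ge0.
rewrite -mulmxA mxE (le_trans (ler_norm_sum _ _ _))//.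
rewrite mulr_suml ler_sum// => i _.
rewrite !mxE mulr_sumr (le_trans (ler_norm_sum _ _ _))//.
rewrite mulr_suml ler_sum// => j _.
rewrite !normrM mulrCA ler_wpM2l//.
have := yN i; have := yN j; rewrite -(real_normK (num_real (y i 0))).
rewrite -(real_normK (num_real (y j 0))).
move: (`|y i 0|) (`|y j 0|) => u v Nv Nu.
(* Here 2uv <= u^2 + v^2 <= 2N. *)
by have := sqr_ge0 (u - v); nra.
Qed.

Lemma spd_open_along_symm m : open_along (@symm R m) (@spd R m).
Proof.
move=> S v spdS symv; have [posL SE] := cholP spdS.
set L := chol S in posL SE; have uL := lower_pos_unitmx posL.
(* S + h v = L (1 + h B) L^T, and 1 + h B is positive once |h| |B|_1 < 1. *)
pose B := invmx L *m v *m (invmx L)^T; pose b := \sum_i \sum_j `|B i j|.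
have vE : v = L *m B *m L^T.
  by rewrite /B !mulmxA mulmxV// mul1mx -mulmxA -trmx_mul mulmxV// trmx1 mulmx1.
have b_ge0 : 0 <= b by do 2 (apply: sumr_ge0 => ? _).
near=> h.
have hb : `|h| * b < 1.
  (* Adding 1 to [b] covers the case [b = 0]. *)
  have : `|h| < (b + 1)^-1.
    by near: h; apply: (@nbhs0_lt _ R^o); rewrite invr_gt0 ltr_wpDl.
  rewrite -[ltRHS]div1r ltr_pdivlMr ?ltr_wpDl//; apply: le_lt_trans.
  by rewrite ler_wpM2l// lerDl.
split; first by rewrite linearD/= linearZ/= symv spdS.1.
move=> x x_neq0; pose y := L^T *m x.
have y_neq0 : y != 0.
  apply: contra_neq x_neq0 => Lx0.
  by rewrite -(mulKmx (_ : L^T \in unitmx) x) -/y ?Lx0 ?mulmx0// unitmx_tr.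
have -> : (x^T *m (h *: v + S) *m x) 0 0 =
    h * (y^T *m B *m y) 0 0 + \sum_i y i 0 ^+ 2.
  rewrite mulmxDr mulmxDl mxE {1}vE SE -mulmx_tr_col; congr (_ + _).
    by rewrite -scalemxAr -scalemxAl mxE /y trmx_mul trmxK !mulmxA.
  by rewrite /y trmx_mul trmxK !mulmxA.
have := sum_sqr_gt0 y_neq0; have := quadratic_form_bound B y.
rewrite -/b; move: (\sum_i _) ((_ *m _ *m _) 0 0) => N Q QN N_gt0.
have : `|h * Q| < N.
  rewrite normrM (le_lt_trans (ler_wpM2l (normr_ge0 h) QN))// mulrA.
  by rewrite gtr_pMl.
by rewrite ltr_norml => /andP[+ _]; rewrite ltrNl -subr_gt0 opprK addrC.
Unshelve. all: by end_near. Qed.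

(** Above the diagonal the entry is 0; otherwise [cholesky_entry] is solved for column [j], by
    strong induction on [j]. *)
Lemma elementary_chol m (i j : 'I_m) :
  elementary (@spd R m) (fun S => chol S i j).
Proof.
have [ij|] := ltnP i j.
  apply: elementary_ext (elementary_cst _ 0) => S /cholP[[trigL _] _].
  by rewrite (is_trig_mxP trigL).
move jn : (nat_of_ord j) => n; elim/ltn_ind: n i j jn => n ih i j jn ji.
pose rest (i : 'I_m) (S : 'M[R]_m) :=
  S i j - \sum_(k < m | (k < j)%N) chol S i k * chol S j k.
have e_rest (i' : 'I_m) : (j <= i')%N -> elementary (@spd R m) (rest i').
  move=> ji'; apply: elementaryD; first exact: elementary_coord.
  apply/elementaryN/elementary_sum => k kj.
  have kn : (k < n)%N by rewrite -jn.
  have ki' : (k <= i')%N := leq_trans (ltnW kj) ji'.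
  exact: elementaryM (ih k kn i' k erefl ki') (ih k kn j k erefl (ltnW kj)).
have restE (i' : 'I_m) S : spd S -> rest i' S = chol S i' j * chol S j j.
  move=> /cholP[[trigL _] SE]; rewrite /rest {1}SE cholesky_entry//.
  by rewrite addrC addKr.
have chol_gt0 (S : 'M[R]_m) : spd S -> 0 < chol S j j.
  by case/cholP => -[_ posL] _.
(* [rest j S] is the square of the pivot, and its square root is written as exp(ln(.)/2). *)
have e_jj : elementary (@spd R m) (fun S => chol S j j).
  have rest_gt0 S : spd S -> 0 < rest j S.
    by move=> spdS; rewrite restE// mulr_gt0// chol_gt0.
  have := elementary_expR (elementaryM (elementary_cst _ 2^-1)
    (elementary_ln rest_gt0 (e_rest j (leqnn _)))).
  apply: elementary_ext => S spdS; rewrite restE// lnM ?posrE ?chol_gt0//.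
  rewrite -mulr2n -[ln _ *+ 2]mulr_natl mulKf ?pnatr_eq0//.
  by rewrite lnK ?posrE ?chol_gt0.
rewrite -jn in ji.
apply: elementary_ext (elementaryM (e_rest i ji) (elementaryV chol_gt0 e_jj)).
by move=> S spdS; rewrite restE// mulfK// gt_eqF ?chol_gt0.
Qed.

End Cholesky.

(** * Log-Cholesky coordinates *)

Lemma sqr_frob (R : realType) (p q : nat) (A : 'M[R]_(p, q)) :
  frob A ^+ 2 = \sum_i \sum_j A i j ^+ 2.
Proof.
rewrite sqr_sqrtr// sumr_ge0// => i _; rewrite sumr_ge0// => j _.
exact: sqr_ge0.
Qed.

Section LogCholeskyCoordinates.
Variables (R : realType) (m : nat) (e : 'I_(m * m.-1)./2 -> 'I_m * 'I_m).
Hypothesis e_order : lower_order e.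
Implicit Types (S T L K : 'M[R]_m) (w : 'cV[R]_(m * m.+1)./2).

Definition lower_index p : 'I_(m * m.+1)./2 :=
  cast_ord (dim_split m) (lshift m p).
Definition diag_index i : 'I_(m * m.+1)./2 :=
  cast_ord (dim_split m) (rshift (m * m.-1)./2 i).

Lemma logchol_lower_index S p :
  logchol e S (lower_index p) 0 = chol S (e p).1 (e p).2.
Proof. by rewrite castmxE cast_ordK cast_ord_id col_mxEu mxE. Qed.

Lemma logchol_diag_index S i :
  logchol e S (diag_index i) 0 = ln (chol S i i).
Proof. by rewrite castmxE cast_ordK cast_ord_id col_mxEd mxE. Qed.

Variant log_index_spec : 'I_(m * m.+1)./2 -> Type :=
| LowerIndex p : log_index_spec (lower_index p)
| DiagIndex i : log_index_spec (diag_index i).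

Lemma log_indexP k : log_index_spec k.
Proof.
rewrite -(cast_ordKV (dim_split m) k).
by case: (split_ordP (cast_ord (esym (dim_split m)) k)) => i ->; constructor.
Qed.

Lemma sum_log_index (F : 'I_(m * m.+1)./2 -> R) :
  \sum_k F k = \sum_p F (lower_index p) + \sum_i F (diag_index i).
Proof.
rewrite (reindex (cast_ord (dim_split m))); last first.
  exact/onW_bij/(Bijective (cast_ordK _) (cast_ordKV _)).
exact: big_split_ord.
Qed.

(** Partial inverse of [e], option-valued because [e] reaches only strictly lower positions; this is
    the shape that [reindex_omap] takes. *)
Definition lower_rank (ij : 'I_m * 'I_m) := [pick p | e p == ij].

Lemma lower_rankK p : lower_rank (e p) = Some p.
Proof.
rewrite /lower_rank; case: pickP => [p' /eqP/e_order.1 -> //|/(_ p)].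
by rewrite eqxx.
Qed.

Lemma lower_rank_omap (ij : 'I_m * 'I_m) :
  (ij.2 < ij.1)%N -> omap e (lower_rank ij) = Some ij.
Proof. by move=> /(e_order.2 ij).2[p <-]; rewrite lower_rankK. Qed.

Lemma lower_rank_None (ij : 'I_m * 'I_m) :
  (ij.1 <= ij.2)%N -> lower_rank ij = None.
Proof.
rewrite leqNgt /lower_rank; case: pickP => // p /eqP ep /negP[].
by apply/(e_order.2 ij); exists p.
Qed.

(** The Cholesky factor with log-Cholesky coordinates [w]; the default 0 of [oapp] fills the upper
    triangle. *)
Definition exp_factor w : 'M[R]_m := \matrix_(i, j)
  if i == j then expR (w (diag_index i) 0)
  else oapp (fun p => w (lower_index p) 0) 0 (lower_rank (i, j)).

Lemma exp_factor_lower_pos w : lower_pos (exp_factor w).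
Proof.
split=> [|i]; last by rewrite mxE eqxx expR_gt0.
apply/is_trig_mxP => i j ij; rewrite mxE -(inj_eq val_inj) ltn_eqF//.
by rewrite lower_rank_None// ltnW.
Qed.

Definition exp_cholesky w := exp_factor w *m (exp_factor w)^T.

Lemma exp_cholesky_spd w : spd (exp_cholesky w).
Proof. exact/spd_mul_tr/exp_factor_lower_pos. Qed.

Lemma logcholK S : spd S -> exp_cholesky (logchol e S) = S.
Proof.
move=> /cholP[[trigL posL] SE].
suff LE : exp_factor (logchol e S) = chol S by rewrite /exp_cholesky LE.
apply/matrixP => i j; rewrite mxE.
have [<-|] := eqVneq; first by rewrite logchol_diag_index lnK// posrE.
rewrite -(inj_eq val_inj) neq_ltn => /orP[ij|ji].
  by rewrite lower_rank_None ?(is_trig_mxP trigL)// ltnW.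
have [p ep] := (e_order.2 (i, j)).2 ji.
by rewrite -ep lower_rankK/= logchol_lower_index ep.
Qed.

(** By uniqueness of the factorisation, [chol] returns [exp_factor w], whose coordinates are then
    read off. *)
Lemma exp_choleskyK w : logchol e (exp_cholesky w) = w.
Proof.
have cholE := chol_mul_tr (exp_factor_lower_pos w).
apply/colP => k; case: (log_indexP k) => [p|i].
  rewrite logchol_lower_index cholE mxE -surjective_pairing lower_rankK/=.
  have /(e_order.2 (e p)).1 : exists p', e p' = e p by exists p.
  by rewrite -(inj_eq val_inj) => /gtn_eqF ->.
by rewrite logchol_diag_index cholE mxE eqxx expRK.
Qed.

Lemma logchol_bij : set_bij (@spd R m) setT (logchol e).
Proof.
split=> // [S T|w _].
  rewrite !inE => spdS spdT VST.
  by rewrite -(logcholK spdS) VST logcholK.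
by exists (exp_cholesky w); [exact: exp_cholesky_spd | exact: exp_choleskyK].
Qed.

(** Replaces the abstract partial inverse by a formula whose entries are visibly elementary. *)
Lemma inverse_logchol w : inverse_on (@spd R m) (logchol e) w = exp_cholesky w.
Proof.
have [_ inj _] := logchol_bij.
rewrite -{1}(exp_choleskyK w) /inverse_on pinvKV// inE.
exact: exp_cholesky_spd.
Qed.

Lemma logchol_diffeomorphism :
  diffeomorphism (@symm R m) (@spd R m) setT setT (logchol e).
Proof.
split; first exact: logchol_bij.
- apply: smooth_on_elementary; first exact: spd_open_along_symm.
  move=> k i; rewrite ord1; case: (log_indexP k) => [p|j].
    apply: elementary_ext (elementary_chol R (e p).1 (e p).2) => S _.
    by rewrite logchol_lower_index.
  have diag_gt0 S : spd S -> 0 < chol S j j by case/cholP => -[_ posL] _.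
  apply: elementary_ext (elementary_ln diag_gt0 (elementary_chol R j j)) => S _.
  by rewrite logchol_diag_index.
- apply: smooth_on_elementary; first by move=> x v _ _; exact: filterT.
  have e_factor i j : elementary setT (fun w => exp_factor w i j).
    have [<-|/negbTE ij] := eqVneq i j.
      apply: elementary_ext
        (elementary_expR (elementary_coord _ (diag_index i) 0)).
      by move=> w _; rewrite mxE eqxx.
    case rank_ij: (lower_rank (i, j)) => [p|].
      apply: elementary_ext (elementary_coord _ (lower_index p) 0) => w _.
      by rewrite mxE ij rank_ij.
    apply: elementary_ext (elementary_cst _ 0) => w _.
    by rewrite mxE ij rank_ij.
  move=> i j.
  have := elementary_sum (index_enum 'I_m) (fun k (_ : predT k) =>
    elementaryM (e_factor i k) (e_factor j k)).
  apply: elementary_ext => w _; rewrite inverse_logchol mxE.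
  by apply: eq_bigr => k _; rewrite [_^T _ _]mxE.
Qed.

Lemma dC_chol S T : dC (chol S) (chol T) = frob (logchol e S - logchol e T).
Proof.
rewrite /dC /(frob (_ - _ : 'cV__)); congr (Num.sqrt _).
rewrite !sqr_frob sum_log_index.
congr (_ + _); last first.
  apply: eq_bigr => i _; rewrite big_ord1 !mxE logchol_diag_index.
  rewrite logchol_diag_index (bigD1 i)//= big1 => [|j ji].
    by rewrite !mxE eqxx !mulr1n addr0.
  by rewrite !mxE eq_sym (negbTE ji) subrr expr0n.
rewrite pair_big/= (bigID (fun ij : 'I_m * 'I_m => ij.2 < ij.1)%N)/=.
rewrite addrC big1 ?add0r => [|ij /negbTE ij_ge]; last first.
  by rewrite !mxE ij_ge subrr expr0n.
(* Only strictly lower pairs remain, and [e] enumerates each of them once. *)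
rewrite (reindex_omap e lower_rank) => [|ij]; last exact: lower_rank_omap.
apply: eq_big => [p|p].
  by rewrite lower_rankK eqxx andbT; apply/(e_order.2 (e p)); exists p.
move=> /andP[ep_lower _].
by rewrite big_ord1 !mxE ep_lower !logchol_lower_index.
Qed.

End LogCholeskyCoordinates.

(** * Frechet means and k-means under isometries *)

(** Once some mean exists, [get] returns a mean, and uniqueness identifies it with [a]. *)
Lemma frechet_meanE (R : realType) (T : pointedType) (M : set T)
    (d : T -> T -> R) (Z : {fset T}) a :
  is_frechet_mean M d Z a -> frechet_mean M d Z = a.
Proof.
move=> mean_a; have [_ _ uniq_a] := mean_a.
by have [Mb minb _] : is_frechet_mean M d Z _ := getI mean_a; apply: uniq_a.
Qed.

Section IsometryTransport.
Variables (R : realType) (T T' : pointedType) (M : set T) (M' : set T').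
Variables (d : T -> T -> R) (d' : T' -> T' -> R) (f : T -> T') (g : T' -> T).
Hypotheses (fM : forall x, M x -> M' (f x)) (gM : forall y, M' y -> M (g y)).
Hypotheses (fK : forall x, M x -> g (f x) = x).
Hypotheses (gK : forall y, M' y -> f (g y) = y).
Hypothesis f_isometry : forall x y, M x -> M y -> d' (f x) (f y) = d x y.
Implicit Types Z : {fset T}.

Lemma imfset_injective Z : (forall x, x \in Z -> M x) -> {in Z &, injective f}.
Proof. by move=> ZM x y /ZM Mx /ZM My fxy; rewrite -(fK Mx) fxy fK. Qed.

Lemma dispersion_imfset Z a : (forall x, x \in Z -> M x) -> M a ->
  dispersion d' (f a) [fset f x | x in Z]%fset = dispersion d a Z.
Proof.
move=> ZM Ma; rewrite /dispersion big_imfset/=; last exact: imfset_injective.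
by apply: eq_big_seq => x /ZM Mx; rewrite f_isometry.
Qed.

(** The dispersions at [y] and at [g y] agree, so minimality and uniqueness both pull back along the
    bijection. *)
Lemma is_frechet_mean_imfset Z b : (forall x, x \in Z -> M x) ->
  is_frechet_mean M' d' [fset f x | x in Z]%fset b ->
  is_frechet_mean M d Z (g b).
Proof.
move=> ZM [Mb minb uniqb].
have dispE y : M' y -> dispersion d' y [fset f x | x in Z]%fset =
    dispersion d (g y) Z.
  by move=> My; rewrite -{1}(gK My) dispersion_imfset//; exact: gM.
split=> [|a Ma|a Ma mina]; first exact: gM.
  by rewrite -dispE// -(fK Ma) -dispE; [apply: minb|]; exact: fM.
rewrite -(uniqb (f a)); [by rewrite fK | exact: fM |].
by move=> c Mc; rewrite !dispE ?fK//; [apply/mina/gM | exact: fM].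
Qed.

Lemma imfset_neq0 Z : ([fset f x | x in Z]%fset != fset0) = (Z != fset0).
Proof.
apply/fset0Pn/fset0Pn => -[x xZ].
  by case/imfsetP: xZ => z /= zZ _; exists z.
by exists (f x); exact: in_imfset.
Qed.

Lemma is_kpartition_imfset k Z (P : 'I_k -> {fset T}) :
  (forall x, x \in Z -> M x) -> is_kpartition Z P ->
  is_kpartition [fset f x | x in Z]%fset (fun j => [fset f x | x in P j]%fset).
Proof.
move=> ZM [coverP disjP]; split=> [y|i j /disjP/fdisjointP disj_ij].
  split=> [/imfsetP[x /= /coverP[j xPj] ->]|[j /imfsetP[x /= xPj ->]]].
    by exists j; exact: in_imfset.
  by apply: in_imfset; apply/coverP; exists j.
apply/fdisjointP => _ /imfsetP[x /= xPi ->]; apply/imfsetP => -[y /= yPj fxy].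
have Mx : M x by apply/ZM/coverP; exists i.
have My : M y by apply/ZM/coverP; exists j.
by have /negP[] := disj_ij x xPi; rewrite -(fK Mx) fxy fK.
Qed.

Hypothesis mean_exists : forall Z' : {fset T'}, Z' != fset0 ->
  (forall y, y \in Z' -> M' y) -> exists b, is_frechet_mean M' d' Z' b.

(** Since [frechet_mean] is a choice, [mean_exists] is used to know that on each nonempty cluster
    both choices are true means, matched by [g]. *)
Lemma kmeans_cost_imfset k (P : 'I_k -> {fset T}) :
  (forall j x, x \in P j -> M x) ->
  kmeans_cost M' d' (fun j => [fset f x | x in P j]%fset) = kmeans_cost M d P.
Proof.
move=> PM; apply: eq_big => [j|j]; rewrite imfset_neq0// => Pj_neq0.
have [|y /imfsetP[x /= /PM Mx ->]|b mean_b] :=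
  mean_exists (Z' := [fset f x | x in P j]%fset).
- by rewrite imfset_neq0.
- exact: fM.
have [Mb _ _] := mean_b.
rewrite (frechet_meanE mean_b).
rewrite (frechet_meanE (is_frechet_mean_imfset _ mean_b)).
  by rewrite -{1}(gK Mb) dispersion_imfset//; [exact: PM | exact: gM].
exact: PM.
Qed.

End IsometryTransport.

Lemma imfsetK (T T' : choiceType) (f : T -> T') (g : T' -> T) (Z : {fset T}) :
  (forall x, x \in Z -> g (f x) = x) ->
  [fset g y | y in [fset f x | x in Z]]%fset = Z.
Proof.
move=> fK; apply/fsetP => x.
apply/imfsetP/idP => [[_ /imfsetP[z /= zZ ->] ->]|xZ].
  by rewrite fK.
by exists (f x); [exact: in_imfset | rewrite fK].
Qed.

(** Competing partitions correspond with equal cost: those of the image are pulled back by [g],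
    those of [Z] are pushed forward by [f]. *)
Lemma solves_kmeans_imfset (R : realType) (T T' : pointedType) (M : set T)
    (M' : set T') (d : T -> T -> R) (d' : T' -> T' -> R) (f : T -> T')
    (g : T' -> T) (k : nat) (Z : {fset T}) (P : 'I_k -> {fset T}) :
  (forall x, M x -> M' (f x)) -> (forall y, M' y -> M (g y)) ->
  (forall x, M x -> g (f x) = x) -> (forall y, M' y -> f (g y) = y) ->
  (forall x y, M x -> M y -> d' (f x) (f y) = d x y) ->
  (forall Z' : {fset T'}, Z' != fset0 -> (forall y, y \in Z' -> M' y) ->
    exists b, is_frechet_mean M' d' Z' b) ->
  (forall x, x \in Z -> M x) -> is_kpartition Z P ->
  solves_kmeans M d Z P <->
  solves_kmeans M' d' [fset f x | x in Z]%fset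
    (fun j => [fset f x | x in P j]%fset).
Proof.
move=> fM gM fK gK f_isometry mean_exists ZM partP.
have cost Q : is_kpartition Z Q ->
    kmeans_cost M' d' (fun j => [fset f x | x in Q j]%fset) = kmeans_cost M d Q.
  move=> [coverQ _]; apply: (kmeans_cost_imfset fM gM fK gK f_isometry) => //.
  by move=> j x xQj; apply/ZM/coverQ; exists j.
split=> -[_ minP]; split=> //.
- exact: (is_kpartition_imfset fK).
- move=> Q' partQ'; have fZM y : y \in [fset f x | x in Z]%fset -> M' y.
    by case/imfsetP => x /= /ZM Mx ->; exact: fM.
  pose Q j := [fset g y | y in Q' j]%fset.
  have partQ : is_kpartition Z Q.
    rewrite -[Z](imfsetK (f := f) (g := g)) => [|x /ZM /fK//].
    exact: (is_kpartition_imfset gK).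
  have -> : Q' = (fun j => [fset f x | x in Q j]%fset).
    apply/funext => j; rewrite imfsetK// => y yQ'j; apply/gK/fZM.
    by apply/partQ'.1; exists j.
  by rewrite !cost//; exact: minP.
- by move=> Q partQ; rewrite -!cost//; apply/minP/(is_kpartition_imfset fK).
Qed.

(** * The centroid as Euclidean Frechet mean *)

Section EuclideanMean.
Variables (R : realType) (n : nat).
Implicit Types (Z : {fset 'cV[R]_n}) (a c u : 'cV[R]_n).

Lemma sqr_dE a u : dE a u ^+ 2 = \sum_i (a i 0 - u i 0) ^+ 2.
Proof.
by rewrite sqr_frob; apply: eq_bigr => i _; rewrite big_ord1 !mxE.
Qed.

Lemma dE_eq0 a u : dE a u ^+ 2 = 0 -> a = u.
Proof.
move/eqP; rewrite sqr_dE psumr_eq0 => [/allP au|i _]; last exact: sqr_ge0.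
apply/colP => i; apply/eqP; rewrite -subr_eq0 -sqrf_eq0.
exact: (implyP (au i (mem_index_enum i))).
Qed.

Definition centroid Z : 'cV[R]_n := (#|` Z|%:R)^-1 *: \sum_(u <- Z) u.

Lemma centroid_imfset (T : choiceType) (f : T -> 'cV[R]_n) (Z : {fset T}) :
  {in Z &, injective f} ->
  centroid [fset f x | x in Z]%fset = (#|` Z|%:R)^-1 *: \sum_(x <- Z) f x.
Proof. by move=> f_inj; rewrite /centroid card_in_imfset// big_imfset. Qed.

(** The parallel axis identity, proved coordinate by coordinate after exchanging the sums. *)
Lemma dispersion_centroid Z a : Z != fset0 ->
  dispersion (@dE R n) a Z =
  dispersion (@dE R n) (centroid Z) Z + #|` Z|%:R * dE a (centroid Z) ^+ 2.
Proof.
move=> Z_neq0; set c := centroid Z.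
(* This kills the cross term in the expansion of (a - u)^2 around [c]. *)
have sum_c i : \sum_(u <- Z) (c i 0 - u i 0) = 0.
  rewrite sumrB big_const_seq count_predT iter_addr_0 -mulr_natl /c mxE.
  rewrite mulVKf ?summxE ?subrr// pnatr_eq0 -lt0n cardfs_gt0//.
rewrite /dispersion; under eq_bigr do rewrite sqr_dE.
under [X in _ = X + _]eq_bigr do rewrite sqr_dE.
rewrite exchange_big [X in _ = X + _]exchange_big/=.
rewrite sqr_dE mulr_sumr -big_split/=.
apply: eq_bigr => i _.
transitivity (\sum_(u <- Z) ((c i 0 - u i 0) ^+ 2 + (a i 0 - c i 0) ^+ 2 +
    2 * (a i 0 - c i 0) * (c i 0 - u i 0))).
  by apply: eq_bigr => u _; ring.
rewrite 2!big_split/= -[X in _ + X]mulr_sumr sum_c mulr0 addr0; congr (_ + _).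
by rewrite big_const_seq count_predT iter_addr_0 mulr_natl.
Qed.

(** The excess over the minimum is a positive multiple of the squared distance to the centroid, so
    it vanishes only there. *)
Lemma centroid_frechet_mean Z : Z != fset0 ->
  is_frechet_mean setT (@dE R n) Z (centroid Z).
Proof.
move=> Z_neq0; have Z_gt0 : 0 < #|` Z|%:R :> R by rewrite ltr0n cardfs_gt0.
split=> // [b _|b _ minb].
  by rewrite (dispersion_centroid b)// lerDl mulr_ge0 ?sqr_ge0// ltW.
have := minb (centroid Z) I; rewrite (dispersion_centroid b)// gerDl.
rewrite pmulr_rle0// => le0; apply/dE_eq0/eqP.
by rewrite eq_le le0 sqr_ge0.
Qed.

End EuclideanMean.

Theorem mainTheorem5 (R : realType) (m : nat) (m_ge1 : (1 <= m)%N)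
    (e : 'I_(m * m.-1)./2 -> 'I_m * 'I_m) (e_order : lower_order e) :
  let V := @logchol R m e in
  [/\ diffeomorphism (@symm R m) (@spd R m) setT setT V,
      {within @spd R m, continuous V},
      (forall K : set 'M[R]_m, K `<=` @spd R m -> compact K ->
         compact (V @` K)),
      (forall S T : 'M[R]_m, spd S -> spd T ->
         dC (chol S) (chol T) = frob (V S - V T))
    & forall Z : {fset 'M[R]_m}, Z != fset0 ->
      (forall S, S \in Z -> spd S) ->
      [/\ is_frechet_mean (@spd R m) (@dLC R m) Z
            (inverse_on (@spd R m) V
               ((#|` Z|%:R)^-1 *: \sum_(S <- Z) V S)),
          frechet_mean (@spd R m) (@dLC R m) Z =
            inverse_on (@spd R m) V
               ((#|` Z|%:R)^-1 *: \sum_(S <- Z) V S)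
        & forall k : nat, (1 <= k)%N ->
          forall P : 'I_k -> {fset 'M[R]_m}, is_kpartition Z P ->
            (solves_kmeans (@spd R m) (@dLC R m) Z P <->
             solves_kmeans setT (@dE R _)
               [fset V S | S in Z]%fset
               (fun j => [fset V S | S in P j]%fset))]].
Proof.
move=> V; have [_ V_inj _] := logchol_bij R e_order.
have V_isometry S T : spd S -> spd T -> dE (V S) (V T) = dLC S T.
  by move=> _ _; rewrite /dLC (dC_chol e_order).
(* Smoothness for the empty list of directions. *)
have V_continuous : {within @spd R m, continuous V}.
  by have [_ /(_ [::])[]] := logchol_diffeomorphism R e_order.
have exp_spd w : [set: 'cV[R]__] w -> spd (exp_cholesky e w).
  by move=> _; exact: exp_cholesky_spd.
have expK w : [set: 'cV[R]__] w -> V (exp_cholesky e w) = w.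
  by move=> _; exact: exp_choleskyK.
have VK S : spd S -> exp_cholesky e (V S) = S by exact: logcholK.
have V_setT S : spd S -> [set: 'cV[R]__] (V S) by [].
split; [exact: logchol_diffeomorphism | exact: V_continuous | | |].
- move=> K Kspd; apply: continuous_compact.
  exact: continuous_subspaceW V_continuous.
- by move=> S T _ _; exact: dC_chol.
move=> Z Z_neq0 Zspd.
have inj_Z : {in Z &, injective V}.
  by move=> S T /Zspd spdS /Zspd spdT; apply: V_inj; rewrite inE.
have mean_Z : is_frechet_mean (@spd R m) (@dLC R m) Z
    (inverse_on (@spd R m) V ((#|` Z|%:R)^-1 *: \sum_(S <- Z) V S)).
  have VZ_neq0 : [fset V S | S in Z]%fset != fset0 by rewrite imfset_neq0.
  have mean_VZ := centroid_frechet_mean VZ_neq0.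
  (* Injectivity of [V] on [Z] turns the average over [Z] into the centroid of the image set. *)
  rewrite -(centroid_imfset inj_Z) inverse_logchol; last by [].
  exact: (is_frechet_mean_imfset V_setT exp_spd VK expK V_isometry Zspd
    mean_VZ).
split; [exact: mean_Z | exact: frechet_meanE mean_Z |].
move=> k _ P partP.
apply: (solves_kmeans_imfset V_setT exp_spd VK expK V_isometry _ Zspd partP).
move=> Z' Z'_neq0 _; exists (centroid Z'); exact: centroid_frechet_mean.
Qed.
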